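(* Let $F$ be a graph. (1) If $F$ has no universal vertex, then $W^*_\kappa[F]=W^*[F]$. (2) If $W^*[F]>3$ and $F$ has no pair of adjacent twins or has no pair of non-adjacent twins, then $W^*_\kappa[F]=W^*[F]$.
   Context: Graphs are finite, simple, undirected, loopless. A vertex is universal if it is adjacent to all other vertices; two vertices are twins if they have the same adjacency to all other vertices of the graph. First-order sentences about graphs use only adjacency $\sim$ and equality $=$. Write $F\sqsubset G$ if $G$ contains an induced copy of $F$. For non-isomorphic $G,H$, $W(G,H)$ is the minimum number of distinct variables in a first-order sentence true on one and false on the other. $W^*[F]=\max\{W(G,H):F\sqsubset G,\ F\not\sqsubset H\}$ and $W^*_\kappa[F]=\min_s\max\{W(G,H): F\sqsubset G,\ F\not\sqsubset H,\ G,H\text{ both }s\text{-connected}\}$. *)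

(* Defs.v *)
From HB Require Import structures.
From mathcomp Require Import all_boot.
From mathcomp Require Import boolp classical_sets.

Set Implicit Arguments.
Unset Strict Implicit.
Unset Printing Implicit Defensive.

(* As usual in first-order logic, structures are nonempty. *)
Record graph := Graph {
  vertex :> finType;
  adj : rel vertex;
  adj_sym : symmetric adj;
  adj_irr : irreflexive adj;
  vertex_gt0 : 0 < #|vertex| }.

Definition universal (G : graph) (u : G) : Prop :=
  forall v : G, v != u -> adj u v.

Definition twins (G : graph) (u v : G) : Prop :=
  u != v /\ forall w : G, w != u -> w != v -> adj u w = adj v w.

Definition induced_sub (F G : graph) : Prop :=
  exists f : F -> G, injective f /\ forall x y, adj (f x) (f y) = adj x y.

(* s-connected: more than s vertices, and deleting fewer than s vertices
   never disconnects the graph. *)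
Definition s_connected (s : nat) (G : graph) : Prop :=
  s < #|G| /\
  forall S : {set G}, #|S| < s ->
    forall u v : G, u \notin S -> v \notin S ->
      connect [rel x y | [&& adj x y, x \notin S & y \notin S]] u v.

Inductive formula : Type :=
| FEq of nat & nat
| FAdj of nat & nat
| FNot of formula
| FAnd of formula & formula
| FOr of formula & formula
| FEx of nat & formula
| FAll of nat & formula.

Definition update (T : Type) (e : nat -> T) (x : nat) (a : T) : nat -> T :=
  fun y => if y == x then a else e y.

Fixpoint sat (G : graph) (e : nat -> G) (p : formula) : Prop :=
  match p with
  | FEq x y => e x = e y
  | FAdj x y => adj (e x) (e y)
  | FNot p => ~ sat e p
  | FAnd p q => sat e p /\ sat e q
  | FOr p q => sat e p \/ sat e q
  | FEx x p => exists a : G, sat (update e x a) p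
  | FAll x p => forall a : G, sat (update e x a) p
  end.

Fixpoint vars (p : formula) : seq nat :=
  match p with
  | FEq x y | FAdj x y => [:: x; y]
  | FNot p => vars p
  | FAnd p q | FOr p q => vars p ++ vars q
  | FEx x p | FAll x p => x :: vars p
  end.

Fixpoint free_vars (p : formula) : seq nat :=
  match p with
  | FEq x y | FAdj x y => [:: x; y]
  | FNot p => free_vars p
  | FAnd p q | FOr p q => free_vars p ++ free_vars q
  | FEx x p | FAll x p => [seq y <- free_vars p | y != x]
  end.

Definition sentence (p : formula) : Prop := free_vars p = [::].

(* Number of distinct variables, bound occurrences included; a variable that is
   requantified is counted once. *)
Definition width (p : formula) : nat := size (undup (vars p)).

(* For a sentence the choice of the assignment is irrelevant. *)
Definition models (G : graph) (p : formula) : Prop :=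
  forall e : nat -> G, sat e p.

Definition distinguishes (p : formula) (G H : graph) : Prop :=
  (models G p /\ ~ models H p) \/ (models H p /\ ~ models G p).

(* Least and greatest element of a set of naturals; 0 if there is none. *)
Definition nat_min (A : set nat) : nat :=
  xget 0 [set k | A k /\ forall j, A j -> k <= j]%classic.
Definition nat_max (A : set nat) : nat :=
  xget 0 [set k | A k /\ forall j, A j -> j <= k]%classic.

Definition W (G H : graph) : nat :=
  nat_min [set k | exists p, [/\ sentence p, distinguishes p G H & width p = k]]%classic.

(* The sets below are bounded by #|F|: the existential closure of the diagram of
   F is a distinguishing sentence. *)
Definition Wstar (F : graph) : nat :=
  nat_max [set k | exists G H : graph,
    [/\ induced_sub F G, ~ induced_sub F H & W G H = k]]%classic.

(* The inner maximum ranges over the empty set only when F has at most two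
   vertices and is complete. *)
Definition Wstar_conn (F : graph) (s : nat) : nat :=
  nat_max [set k | exists G H : graph,
    [/\ induced_sub F G, ~ induced_sub F H, s_connected s G, s_connected s H
      & W G H = k]]%classic.

Definition Wstar_kappa (F : graph) : nat :=
  nat_min [set k | exists s : nat, Wstar_conn F s = k]%classic.

(* Main.v *)
Require Import Defs.
From mathcomp Require Import all_boot.
From mathcomp Require Import boolp classical_sets.

(** In each case a pair [G], [H] attaining [Wstar F] is turned, for every [s],
    into an [s]-connected pair of the same kind whose [W] is not smaller; the
    bound on [W] comes from translating a sentence about the new graphs into one
    about the old graphs without introducing new variables.  If [F] has no
    universal vertex, join both graphs with the complete graph on [s] vertices.
    Otherwise [F] is connected, so it lies in one component of [G].  Three
    variables suffice to express that two vertices are in the same component of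
    a graph of bounded size, hence some component of [H] is at least as hard to
    separate from it as [H] from [G].  Finally replace every vertex of these two
    components by a large clique if [F] has no adjacent twins, and by a large
    independent set if [F] has no non-adjacent twins. *)

Set Implicit Arguments.
Unset Strict Implicit.
Unset Printing Implicit Defensive.

(** * Extrema of sets of naturals *)

Lemma nat_minP (A : set nat) n :
  A n -> A (nat_min A) /\ forall j, A j -> nat_min A <= j.
Proof.
move=> An; rewrite /nat_min.
have exA : exists k, `[<A k>] by exists n; apply/asboolP.
pose m := ex_minn exA.
have mP : A m /\ forall j, A j -> m <= j.
  rewrite /m; case: ex_minnP => k /asboolP Ak kmin; split=> // j Aj.
  exact/kmin/asboolP.
by case: (xgetPex 0 (ex_intro (fun k => A k /\ forall j, A j -> k <= j) m mP)).
Qed.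

Lemma nat_maxP (A : set nat) n N : A n -> (forall j, A j -> j <= N) ->
  A (nat_max A) /\ forall j, A j -> j <= nat_max A.
Proof.
move=> An leN; rewrite /nat_max.
have exA : exists k, `[<A k>] by exists n; apply/asboolP.
have ubA j : `[<A j>] -> j <= N by move/asboolP/leN.
pose m := ex_maxn exA ubA.
have mP : A m /\ forall j, A j -> j <= m.
  rewrite /m; case: ex_maxnP => k /asboolP Ak kmax; split=> // j Aj.
  exact/kmax/asboolP.
by case: (xgetPex 0 (ex_intro (fun k => A k /\ forall j, A j -> j <= k) m mP)).
Qed.

Lemma nat_max_empty (A : set nat) : (forall n, ~ A n) -> nat_max A = 0.
Proof. by move=> A0; apply: xgetPN => k [/A0]. Qed.

(** * Formulas *)

Lemma updateE (T : Type) (e : nat -> T) x a : update e x a x = a.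
Proof. by rewrite /update eqxx. Qed.

Lemma update_neq (T : Type) (e : nat -> T) x a y :
  y != x -> update e x a y = e y.
Proof. by rewrite /update => /negbTE ->. Qed.

Lemma sat_free_vars (G : graph) p (e e' : nat -> G) :
  {in free_vars p, e =1 e'} -> sat e p <-> sat e' p.
Proof.
have upd x p' (d d' : nat -> G) a :
  {in [seq y <- free_vars p' | y != x], d =1 d'} ->
  {in free_vars p', update d x a =1 update d' x a}.
  move=> dd' y yp; rewrite /update; case: eqVneq => // yx.
  by apply: dd'; rewrite mem_filter yx.
elim: p e e' => [x y|x y|p IH|p IHp q IHq|p IHp q IHq|x p IH|x p IH] e e' /= ee'.
- by rewrite !ee' // !inE eqxx ?orbT.
- by rewrite !ee' // !inE eqxx ?orbT.
- by have := IH _ _ ee'; tauto.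
- have := IHp e e'; have := IHq e e'.
  move=> -[|? ?]; first by move=> y yq; apply: ee'; rewrite mem_cat yq orbT.
  move=> -[|? ?]; first by move=> y yq; apply: ee'; rewrite mem_cat yq.
  by split=> -[? ?]; split; auto.
- have := IHp e e'; have := IHq e e'.
  move=> -[|? ?]; first by move=> y yq; apply: ee'; rewrite mem_cat yq orbT.
  move=> -[|? ?]; first by move=> y yq; apply: ee'; rewrite mem_cat yq.
  by split=> -[?|?]; auto.
- by split=> -[a sa]; exists a; have := IH _ _ (upd _ _ _ _ a ee'); tauto.
- by split=> sa a; have := IH _ _ (upd _ _ _ _ a ee'); have := sa a; tauto.
Qed.

Lemma sentence_sat (G : graph) p (e e' : nat -> G) :
  sentence p -> sat e p <-> sat e' p.
Proof. by move=> sp; apply: sat_free_vars; rewrite sp. Qed.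

Lemma vertex_inhabited (G : graph) : exists x : G, true.
Proof. by have /card_gt0P[x _] := vertex_gt0 G; exists x. Qed.

Lemma models_sat (G : graph) p (e : nat -> G) :
  sentence p -> models G p <-> sat e p.
Proof. by move=> sp; split=> [/(_ e)//|se e']; apply/(sentence_sat e e' sp). Qed.

Lemma free_vars_sub p : {subset free_vars p <= vars p}.
Proof.
elim: p => //= [x z|x z|p IHp q IHq|p IHp q IHq|x p IH|x p IH] y //.
- by rewrite !mem_cat => /orP[/IHp->|/IHq->]; rewrite ?orbT.
- by rewrite !mem_cat => /orP[/IHp->|/IHq->]; rewrite ?orbT.
- by rewrite mem_filter inE => /andP[_ /IH->]; rewrite orbT.
- by rewrite mem_filter inE => /andP[_ /IH->]; rewrite orbT.
Qed.

Lemma sentence_sub p (q : formula) :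
  sentence q -> {subset free_vars p <= free_vars q} -> sentence p.
Proof.
rewrite /sentence => ->; case: (free_vars p) => // x s /(_ x).
by rewrite inE eqxx => /(_ isT).
Qed.

Lemma width_le p s : {subset vars p <= s} -> width p <= size s.
Proof.
move=> ps; apply: uniq_leq_size (undup_uniq _) _ => x.
by rewrite mem_undup => /ps.
Qed.

(** Negating a sentence exchanges the two graphs and keeps its variables, so the direction of a
    separation may be prescribed at no cost in width. *)
Lemma distinguishes_oriented p G H : sentence p -> distinguishes p G H ->
  exists q, [/\ sentence q, models G q, ~ models H q & vars q = vars p].
Proof.
move=> sp [[mG mH]|[mH mG]]; first by exists p.
exists (FNot p); split=> // [e /=|].
  by move/(models_sat e sp).
have [x _] := vertex_inhabited H.
by move=> /(_ (fun=> x)); apply; apply: mH.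
Qed.

Lemma W_le p G H : sentence p -> distinguishes p G H -> W G H <= width p.
Proof.
move=> sp dp; rewrite /W; set A := (X in nat_min X).
have Ap : A (width p) by exists p.
by have [_] := nat_minP Ap; apply.
Qed.

(** The given [p] shows that the set of widths is nonempty, so its minimum is attained instead of
    being the default 0. *)
Lemma W_attained p G H : sentence p -> distinguishes p G H ->
  exists q, [/\ sentence q, distinguishes q G H & width q = W G H].
Proof.
move=> sp dp; rewrite /W; set A := (X in nat_min X).
have Ap : A (width p) by exists p.
by have [] := nat_minP Ap.
Qed.

(** * Renaming of variables *)

Fixpoint rename (f : nat -> nat) (p : formula) : formula :=
  match p with
  | FEq x y => FEq (f x) (f y)
  | FAdj x y => FAdj (f x) (f y)
  | FNot p => FNot (rename f p)
  | FAnd p q => FAnd (rename f p) (rename f q)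
  | FOr p q => FOr (rename f p) (rename f q)
  | FEx x p => FEx (f x) (rename f p)
  | FAll x p => FAll (f x) (rename f p)
  end.

Lemma vars_rename f p : vars (rename f p) = map f (vars p).
Proof.
by elim: p => //= [p -> q ->|p -> q ->|x p ->|x p ->]; rewrite ?map_cat.
Qed.

Lemma free_vars_rename f p : injective f ->
  free_vars (rename f p) = map f (free_vars p).
Proof.
move=> injf; elim: p => //= [p -> q ->|p -> q ->|x p ->|x p ->].
- by rewrite map_cat.
- by rewrite map_cat.
- by rewrite filter_map; congr map; apply: eq_filter => y /=; rewrite inj_eq.
- by rewrite filter_map; congr map; apply: eq_filter => y /=; rewrite inj_eq.
Qed.

Lemma sat_rename (G : graph) f p (e : nat -> G) : injective f ->
  sat e (rename f p) <-> sat (fun x => e (f x)) p.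
Proof.
move=> injf.
have upd d x (a : G) :
  (fun y => update d (f x) a (f y)) = update (fun y => d (f y)) x a.
  by apply/funext => y; rewrite /update inj_eq.
elim: p e => //= [p IH|p IHp q IHq|p IHp q IHq|x p IH|x p IH] e.
- by rewrite IH.
- by rewrite IHp IHq.
- by rewrite IHp IHq.
- by split=> -[a]; rewrite ?IH => sa; exists a; move: sa; rewrite ?IH upd.
- by split=> sa a; have := sa a; rewrite ?IH upd.
Qed.

(** Brings sentences that separate different pairs to one common pool of [m] variables, so that
    their conjunction stays within [m] variables. *)
Lemma rename_iota G H p m : sentence p -> models G p -> ~ models H p ->
  width p <= m ->
  exists q, [/\ sentence q, models G q, ~ models H q
    & {subset vars q <= iota 0 m}].
Proof.
move=> sp mG mH wp; pose s := undup (vars p).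
(* [index] packs the occurring variables into an initial segment; shifting all others past it makes
   [f] injective on the whole of [nat], so that no variable is captured. *)
pose f x := if x \in s then index x s else x + size s.
have injf : injective f.
  move=> x y; rewrite /f; case: ifP => xs; case: ifP => ys.
  - by move=> eqi; rewrite -(nth_index 0 xs) eqi nth_index.
  - move=> eqi; have := xs; rewrite -index_mem eqi.
    by rewrite ltnNge leq_addl.
  - move=> eqi; have := ys; rewrite -index_mem -eqi.
    by rewrite ltnNge leq_addl.
  - exact: addIn.
have sq : sentence (rename f p).
  by rewrite /sentence free_vars_rename // sp.
have mq K : models K (rename f p) <-> models K p.
  have [x _] := vertex_inhabited K.
  by rewrite (models_sat (fun=> x) sq) (models_sat (fun=> x) sp) sat_rename.
exists (rename f p); split=> //; [exact/mq|by move/mq|].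
move=> x; rewrite vars_rename => /mapP[y yp ->].
rewrite mem_iota /= add0n (leq_trans _ wp) // /f mem_undup yp index_mem.
by rewrite mem_undup.
Qed.

Definition ftop x := FAll x (FEq x x).

(** Closed truth constants; they take a variable as parameter so that one already in use can be
    recycled. *)
Definition fconst x (b : bool) := if b then ftop x else FNot (ftop x).

Lemma sat_fconst (G : graph) (e : nat -> G) x b : sat e (fconst x b) <-> b.
Proof. by case: b => //=; split=> // /(_ (fun=> erefl)). Qed.

Lemma vars_fconst x b : vars (fconst x b) = [:: x; x; x].
Proof. by case: b. Qed.

Lemma free_vars_fconst x b : free_vars (fconst x b) = [::].
Proof. by case: b; rewrite /= eqxx. Qed.

(* The variable [x] only serves to write the empty conjunction. *)
Definition bigand (T : Type) x (s : seq T) (P : T -> formula) :=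
  foldr (fun i => FAnd (P i)) (fconst x true) s.

Definition bigor (T : Type) x (s : seq T) (P : T -> formula) :=
  foldr (fun i => FOr (P i)) (fconst x false) s.

Section BigConnectives.
Variables (T : eqType) (x : nat) (s : seq T) (P : T -> formula).

Lemma sat_bigand (G : graph) (e : nat -> G) :
  sat e (bigand x s P) <-> {in s, forall i, sat e (P i)}.
Proof.
rewrite /bigand; elim: s => [|i r IH]; first by split=> // _; apply/sat_fconst.
rewrite /= IH; split=> [[Pi Pr] j|Pir].
  by rewrite inE => /orP[/eqP->|/Pr].
by split=> [|j jr]; apply: Pir; rewrite inE ?eqxx ?jr ?orbT.
Qed.

Lemma sat_bigor (G : graph) (e : nat -> G) :
  sat e (bigor x s P) <-> exists2 i, i \in s & sat e (P i).
Proof.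
rewrite /bigor; elim: s => [|i r IH].
  by split=> [/sat_fconst|[]].
rewrite /= IH; split=> [[Pi|[j jr Pj]]|[j]].
- by exists i; rewrite ?inE ?eqxx.
- by exists j; rewrite ?inE ?jr ?orbT.
- by rewrite inE => /orP[/eqP->|jr] Pj; [left|right; exists j].
Qed.

Lemma vars_bigand (v : seq nat) :
  x \in v -> {in s, forall i, {subset vars (P i) <= v}} ->
  {subset vars (bigand x s P) <= v}.
Proof.
move=> xv; rewrite /bigand; elim: s => [_ y|i r IH Pv y].
  by rewrite vars_fconst !inE !orbb => /eqP->.
rewrite /= mem_cat => /orP[|]; first by apply: Pv; rewrite inE eqxx.
by apply: IH => j jr; apply: Pv; rewrite inE jr orbT.
Qed.

Lemma vars_bigor (v : seq nat) :
  x \in v -> {in s, forall i, {subset vars (P i) <= v}} ->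
  {subset vars (bigor x s P) <= v}.
Proof.
move=> xv; rewrite /bigor; elim: s => [_ y|i r IH Pv y].
  by rewrite vars_fconst !inE !orbb => /eqP->.
rewrite /= mem_cat => /orP[|]; first by apply: Pv; rewrite inE eqxx.
by apply: IH => j jr; apply: Pv; rewrite inE jr orbT.
Qed.

Lemma free_vars_bigand (v : seq nat) :
  {in s, forall i, {subset free_vars (P i) <= v}} ->
  {subset free_vars (bigand x s P) <= v}.
Proof.
rewrite /bigand; elim: s => [_ y|i r IH Pv y].
  by rewrite free_vars_fconst.
rewrite /= mem_cat => /orP[|]; first by apply: Pv; rewrite inE eqxx.
by apply: IH => j jr; apply: Pv; rewrite inE jr orbT.
Qed.

Lemma free_vars_bigor (v : seq nat) :
  {in s, forall i, {subset free_vars (P i) <= v}} ->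
  {subset free_vars (bigor x s P) <= v}.
Proof.
rewrite /bigor; elim: s => [_ y|i r IH Pv y].
  by rewrite free_vars_fconst.
rewrite /= mem_cat => /orP[|]; first by apply: Pv; rewrite inE eqxx.
by apply: IH => j jr; apply: Pv; rewrite inE jr orbT.
Qed.

End BigConnectives.

Definition exs (s : seq nat) p := foldr FEx p s.

Lemma sat_exs (G : graph) s p (e : nat -> G) :
  sat e (exs s p) <->
  exists e' : nat -> G, (forall x, x \notin s -> e' x = e x) /\ sat e' p.
Proof.
rewrite /exs; elim: s e => [|x s IH] e /=.
  split=> [se|[e' [e'e se']]]; first by exists e.
  by apply/(sat_free_vars _).1: se' => x _; rewrite e'e.
split=> [[a /IH[e' [e'e se']]]|[e' [e'e se']]].
  exists e'; split=> // y; rewrite inE negb_or => /andP[yx ys].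
  by rewrite e'e // update_neq.
exists (e' x); apply/IH; exists e'; split=> // y ys.
rewrite /update; case: eqVneq => [->//|yx].
by apply: e'e; rewrite inE negb_or yx.
Qed.

Lemma vars_exs s p : vars (exs s p) = s ++ vars p.
Proof. by elim: s => //= x s ->. Qed.

Lemma sentence_exs s p : {subset free_vars p <= s} -> sentence (exs s p).
Proof.
move=> ps; suff E : free_vars (exs s p) = [seq y <- free_vars p | y \notin s].
  rewrite /sentence E; apply/eqP; rewrite -[_ == _]negbK -has_filter.
  by apply/hasPn => y /ps; rewrite negbK.
elim: s {ps} => [|x s IH] /=; first by rewrite filter_predT.
by rewrite IH -filter_predI; apply: eq_filter => y; rewrite /= inE negb_or.
Qed.

(** * Diagrams *)

(** The variable numbered [enum_rank x] stands for the image of the vertex [x]. *)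
Definition diagram (F : graph) : formula :=
  exs (iota 0 #|F|)
    (bigand 0 (enum {: F * F}) (fun xy =>
       let: (x, y) := xy in
       let i : nat := enum_rank x in let j : nat := enum_rank y in
       FAnd (if x == y then fconst 0 true else FNot (FEq i j))
            (if adj x y then FAdj i j else FNot (FAdj i j)))).

Lemma vars_diagram F : {subset vars (diagram F) <= iota 0 #|F|}.
Proof.
have r (x : F) : (enum_rank x : nat) \in iota 0 #|F|.
  by rewrite mem_iota /= add0n.
have z : 0 \in iota 0 #|F| by rewrite mem_iota /= vertex_gt0.
move=> v; rewrite vars_exs mem_cat orbC => /orP[|//].
apply: vars_bigand => // -[x y] _ w.
rewrite /= mem_cat; case: ifP => _; case: ifP => _;
  rewrite ?vars_fconst /= !inE => H;
  by repeat case/orP: H => H; move/eqP: H => ->.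
Qed.

Lemma sentence_diagram F : sentence (diagram F).
Proof.
apply: sentence_exs => v /free_vars_sub; move: (@vars_diagram F v).
by rewrite vars_exs mem_cat => H ?; apply: H; apply/orP; right.
Qed.

Lemma models_diagram F G : models G (diagram F) <-> induced_sub F G.
Proof.
have [g _] := vertex_inhabited G.
rewrite (models_sat (fun=> g) (sentence_diagram F)) sat_exs; split.
  move=> [e [_ /sat_bigand se]].
  exists (fun x => e (enum_rank x)).
  have {}se x y := se (x, y) (mem_enum _ _).
  split=> [x y exy|x y]; have [] := se x y.
    by case: eqVneq => //= xy; rewrite exy.
  by move=> _; case: (adj x y) => //= /negP/negbTE.
move=> [f [injf adjf]]; have [x0 _] := vertex_inhabited F.
pose x_ i := nth x0 (enum F) i.
exists (fun i => if i < #|F| then f (x_ i) else g); split.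
  by move=> i; rewrite mem_iota /= add0n => /negbTE ->.
apply/sat_bigand => -[x y] _ /=.
have nthr z : f (x_ (enum_rank z)) = f z.
  by rewrite /x_ -[z in RHS](enum_rankK z) (enum_val_nth x0).
split.
  case: eqVneq => [//|xy].
  by rewrite /= !ltn_ord !nthr => /injf/eqP; apply/negP.
by case: ifP => a /=; rewrite !ltn_ord !nthr adjf a.
Qed.

Lemma diagram_distinguishes F G H : induced_sub F G -> ~ induced_sub F H ->
  distinguishes (diagram F) G H.
Proof. by move=> FG FH; left; rewrite !models_diagram. Qed.

Lemma W_le_card F G H : induced_sub F G -> ~ induced_sub F H ->
  W G H <= #|F|.
Proof.
move=> FG FH.
apply: leq_trans (W_le (sentence_diagram F) (diagram_distinguishes FG FH)) _.
by have := width_le (@vars_diagram F); rewrite size_iota.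
Qed.

(** Restricting to [s]-connected pairs can only lower the maximum. If every optimal pair lifts for
    every [s], then [Wstar_conn F s] equals [Wstar F] for all [s], and the minimum over [s] ranges
    over a single value. *)
Lemma Wstar_kappa_eq F :
  (forall s G H, induced_sub F G -> ~ induced_sub F H -> W G H = Wstar F ->
    exists G' H', [/\ induced_sub F G', ~ induced_sub F H',
      s_connected s G', s_connected s H' & W G H <= W G' H']) ->
  Wstar_kappa F = Wstar F.
Proof.
move=> lift.
suff conn s : Wstar_conn F s = Wstar F.
  rewrite /Wstar_kappa; set A := (X in nat_min X).
  have A0 : A (Wstar F) by exists 0.
  by have [[s <-] _] := nat_minP A0; apply: conn.
move: lift; rewrite /Wstar /Wstar_conn.
set A := (X in nat_max X = _); set B := (X in _ = nat_max X) => lift.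
have subAB k : A k -> B k by move=> [G [H [FG FH _ _ <-]]]; exists G, H.
(* If no pair is separated by containing [F], both maxima take the default value 0. *)
have [/forallNP B0|/contrapT[k Bk]] := pselect (~ exists k, B k).
  by rewrite !nat_max_empty // => k /subAB/B0.
have leF j : B j -> j <= #|F|.
  by move=> [G [H [FG FH <-]]]; apply: W_le_card.
have [[G [H [FG FH WB]]] maxB] := nat_maxP Bk leF.
have [G' [H' [FG' FH' cG' cH' le]]] := lift s G H FG FH WB.
have AW : A (W G' H') by exists G', H'.
have [Amax maxA] := nat_maxP AW (fun j Aj => leF j (subAB j Aj)).
apply/eqP; rewrite eqn_leq (maxB _ (subAB _ Amax)) /= -WB.
exact: leq_trans le (maxA _ AW).
Qed.

(** * Quantifier-free interpretations *)

Section Interpretation.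

(* A vertex of the interpreted graph is named by a vertex of the original graph
   and a tag in [I]; [E i j x y] and [A i j x y] express equality and adjacency
   of the vertices named by [(x, i)] and [(y, j)]. *)
Variables (I : finType) (E A : I -> I -> nat -> nat -> formula).

(** The tags of the variables are recorded by [t], outside the formula. A quantifier over named
    vertices becomes one quantifier over the original graph followed by a finite disjunction or
    conjunction over tags, so no variable is added. *)
Fixpoint interp (t : nat -> I) (p : formula) : formula :=
  match p with
  | FEq x y => E (t x) (t y) x y
  | FAdj x y => A (t x) (t y) x y
  | FNot p => FNot (interp t p)
  | FAnd p q => FAnd (interp t p) (interp t q)
  | FOr p q => FOr (interp t p) (interp t q)
  | FEx x p => FEx x (bigor x (enum I) (fun i => interp (update t x i) p))
  | FAll x p => FAll x (bigand x (enum I) (fun i => interp (update t x i) p))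
  end.

Definition interprets (G G' : graph) (h : G -> I -> G') : Prop :=
  [/\ forall z, exists a i, z = h a i,
      forall i j x y (e : nat -> G),
        sat e (E i j x y) <-> h (e x) i = h (e y) j
    & forall i j x y (e : nat -> G),
        sat e (A i j x y) <-> adj (h (e x) i) (h (e y) j)].

Lemma sat_interp (G G' : graph) (h : G -> I -> G') p t (e : nat -> G) :
  interprets h ->
  sat e (interp t p) <-> sat (fun x => h (e x) (t x)) p.
Proof.
move=> [hsurj hE hA].
have upd e' t' x a i : (fun y => h (update e' x a y) (update t' x i y)) =
    update (fun y => h (e' y) (t' y)) x (h a i).
  by apply/funext => y; rewrite /update; case: eqP.
elim: p t e => //= [p IH|p IHp q IHq|p IHp q IHq|x p IH|x p IH] t e.
- by rewrite IH.
- by rewrite IHp IHq.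
- by rewrite IHp IHq.
- split=> [[a /sat_bigor[i _ /IH]]|[z]].
    by rewrite upd => sa; exists (h a i).
  have [a [i ->]] := hsurj z => sa; exists a; apply/sat_bigor.
  by exists i; [rewrite mem_enum|apply/IH; rewrite upd].
- split=> [se z|se a].
    have [a [i ->]] := hsurj z; have /sat_bigand := se a.
    by move=> /(_ i (mem_enum _ _))/IH; rewrite upd.
  by apply/sat_bigand => i _; apply/IH; rewrite upd.
Qed.

Hypothesis varsE : forall i j x y, {subset vars (E i j x y) <= [:: x; y]}.
Hypothesis varsA : forall i j x y, {subset vars (A i j x y) <= [:: x; y]}.

Lemma vars_interp t p : {subset vars (interp t p) <= vars p}.
Proof.
elim: p t => //= [p IHp q IHq|p IHp q IHq|x p IH|x p IH] t y.
- by rewrite !mem_cat => /orP[/IHp->|/IHq->]; rewrite ?orbT.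
- by rewrite !mem_cat => /orP[/IHp->|/IHq->]; rewrite ?orbT.
- rewrite inE => /orP[/eqP->|]; first by rewrite inE eqxx.
  apply: vars_bigor; first by rewrite inE eqxx.
  by move=> i _ z /IH zp; rewrite inE zp orbT.
- rewrite inE => /orP[/eqP->|]; first by rewrite inE eqxx.
  apply: vars_bigand; first by rewrite inE eqxx.
  by move=> i _ z /IH zp; rewrite inE zp orbT.
Qed.

Lemma free_vars_interp t p : {subset free_vars (interp t p) <= free_vars p}.
Proof.
elim: p t => //= [x y|x y|p IHp q IHq|p IHp q IHq|x p IH|x p IH] t z.
- by move/free_vars_sub/varsE.
- by move/free_vars_sub/varsA.
- by rewrite !mem_cat => /orP[/IHp->|/IHq->]; rewrite ?orbT.
- by rewrite !mem_cat => /orP[/IHp->|/IHq->]; rewrite ?orbT.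
- rewrite !mem_filter => /andP[-> zb] /=; move: z zb.
  by apply: free_vars_bigor => i _; apply: IH.
- rewrite !mem_filter => /andP[-> zb] /=; move: z zb.
  by apply: free_vars_bigand => i _; apply: IH.
Qed.

(** An optimal sentence for [G'] and [H'] pulls back along [interp] to a sentence separating [G] and
    [H] with the same variables; [p] ensures that such an optimal sentence exists. *)
Lemma W_interp (G G' H H' : graph) (h : G -> I -> G') (k : H -> I -> H') p :
  interprets h -> interprets k -> sentence p -> distinguishes p G' H' ->
  W G H <= W G' H'.
Proof.
move=> hh hk sp /(W_attained sp)[q [sq dq <-]].
have [g _] := vertex_inhabited G'; have [i] : exists i : I, true.
  by case: hh => /(_ g)[_ [i _]] _ _; exists i.
(* The initial tag is arbitrary, since a sentence does not depend on the assignment. *)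
move=> _; pose q' := interp (fun=> i) q.
have sq' : sentence q' by apply: sentence_sub sq _; apply: free_vars_interp.
have mq' (K K' : graph) (l : K -> I -> K') : interprets l ->
    models K q' <-> models K' q.
  have [x _] := vertex_inhabited K; move=> hl.
  rewrite (models_sat (fun=> x) sq') (models_sat (fun=> l x i) sq).
  exact: (sat_interp q (fun=> i) (fun=> x) hl).
have dq' : distinguishes q' G H.
  by rewrite /distinguishes (mq' _ _ _ hh) (mq' _ _ _ hk).
apply: leq_trans (W_le sq' dq') _; apply: width_le => x.
by move/vars_interp; rewrite mem_undup.
Qed.

End Interpretation.

(** * Join with a complete graph *)

Section Join.
Variable s : nat.

Definition join_adj (G : graph) (u v : G + 'I_s) : bool :=
  match u, v with
  | inl x, inl y => adj x y
  | inr i, inr j => i != j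
  | _, _ => true
  end.

Lemma join_sym G : symmetric (@join_adj G).
Proof. by move=> [x|i] [y|j] //=; [apply: adj_sym|rewrite eq_sym]. Qed.

Lemma join_irr G : irreflexive (@join_adj G).
Proof. by move=> [x|i] /=; [apply: adj_irr|rewrite eqxx]. Qed.

Lemma join_gt0 (G : graph) : 0 < #|{: G + 'I_s}|.
Proof. by rewrite card_sum addn_gt0 vertex_gt0. Qed.

Definition join (G : graph) : graph :=
  Graph (@join_sym G) (@join_irr G) (join_gt0 G).

(** Fewer than [s] deletions spare some vertex of the added clique, and it is adjacent to everything
    that remains. *)
Lemma s_connected_join (G : graph) : s_connected s (join G).
Proof.
split; first by rewrite card_sum card_ord -add1n leq_add2r vertex_gt0.
move=> S ltS u v uS vS.
have [i iS] : exists i : 'I_s, (inr i : join G) \notin S.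
  apply/existsP; rewrite -[X in is_true X]negbK negb_exists.
  apply/negP => /forallP allS.
  have sub : [set (inr i : join G) | i : 'I_s] \subset S.
    by apply/fintype.subsetP => _ /imsetP[i _ ->]; have := allS i; rewrite negbK.
  have := leq_ltn_trans (subset_leq_card sub) ltS.
  by rewrite card_imset ?card_ord ?ltnn // => a b [].
have toi w : w != inr i -> adj (w : join G) (inr i).
  by case: w => //= j; apply: contraNneq => ->.
apply: (@connect_trans _ _ (inr i)).
  case: (eqVneq u (inr i)) => [->//|ui].
  by apply: connect1; rewrite /= uS iS !andbT; apply: toi.
case: (eqVneq v (inr i)) => [->//|vi].
apply: connect1; rewrite /= vS iS !andbT.
by have := toi v vi; rewrite adj_sym.
Qed.

(** The tag [None] names an original vertex and [Some i] the [i]-th clique vertex, whatever the base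
    vertex is. *)
Definition joinE (i j : option 'I_s) x y :=
  match i, j with
  | None, None => FEq x y
  | Some i, Some j => fconst x (i == j)
  | _, _ => fconst x false
  end.

Definition joinA (i j : option 'I_s) x y :=
  match i, j with
  | None, None => FAdj x y
  | Some i, Some j => fconst x (i != j)
  | _, _ => fconst x true
  end.

Definition join_map (G : graph) (x : G) (i : option 'I_s) : join G :=
  if i is Some i then inr i else inl x.

Lemma join_interprets G : interprets joinE joinA (@join_map G).
Proof.
split=> [[x|i]|[i|] [j|] x y e|[i|] [j|] x y e].
- by exists x, None.
- by have [x _] := vertex_inhabited G; exists x, (Some i).
- by rewrite sat_fconst; split=> [/eqP->|[->]].
- by rewrite sat_fconst.
- by rewrite sat_fconst.
- by split=> [->|[]].
- exact: sat_fconst.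
- exact: sat_fconst.
- exact: sat_fconst.
- by [].
Qed.

Lemma vars_joinE i j x y : {subset vars (joinE i j x y) <= [:: x; y]}.
Proof.
move=> z; case: i j => [i|] [j|]; rewrite ?vars_fconst //= !inE !orbb;
by move=> ->.
Qed.

Lemma vars_joinA i j x y : {subset vars (joinA i j x y) <= [:: x; y]}.
Proof.
move=> z; case: i j => [i|] [j|]; rewrite ?vars_fconst //= !inE !orbb;
by move=> ->.
Qed.

Lemma induced_sub_join F G : induced_sub F G -> induced_sub F (join G).
Proof.
move=> [f [injf adjf]]; exists (fun x => inl (f x)); split=> //.
by move=> x y [/injf].
Qed.

(** A vertex of [F] sent into the added clique would be universal in [F]. *)
Lemma induced_sub_joinV (F G : graph) : (~ exists u : F, universal u) ->
  induced_sub F (join G) -> induced_sub F G.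
Proof.
move=> nou [f [injf adjf]].
have left x : exists y, f x = inl y.
  case fx: (f x) => [y|i]; first by exists y.
  case: nou; exists x => y yx; rewrite -adjf fx.
  case fy: (f y) => [//|j] /=; apply: contraNneq yx => ij.
  by apply/eqP/injf; rewrite fx fy ij.
have [g fg] := choice left; exists g; split=> [x y gxy|x y].
  by apply: injf; rewrite !fg gxy.
by rewrite -adjf !fg.
Qed.

Lemma W_join (F G H : graph) : (~ exists u : F, universal u) ->
  induced_sub F G -> ~ induced_sub F H -> W G H <= W (join G) (join H).
Proof.
move=> nou FG FH.
have FG' := induced_sub_join FG.
have FH' : ~ induced_sub F (join H) by move/(induced_sub_joinV nou).
exact: (W_interp vars_joinE vars_joinA (@join_interprets G)
  (@join_interprets H) (sentence_diagram F) (diagram_distinguishes FG' FH')).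
Qed.

End Join.

(** * Blow-ups *)

Section Blowup.

(* Every vertex is replaced by [n.+1] twins, adjacent iff [b]. *)
Variables (b : bool) (n : nat).

Definition blowup_adj (G : graph) (u v : G * 'I_n.+1) : bool :=
  adj u.1 v.1 || [&& b, u.1 == v.1 & u.2 != v.2].

Lemma blowup_sym G : symmetric (@blowup_adj G).
Proof.
by move=> u v; rewrite /blowup_adj adj_sym (eq_sym u.1) (eq_sym u.2).
Qed.

Lemma blowup_irr G : irreflexive (@blowup_adj G).
Proof. by move=> u; rewrite /blowup_adj adj_irr !eqxx !andbF. Qed.

Lemma blowup_gt0 (G : graph) : 0 < #|{: G * 'I_n.+1}|.
Proof. by rewrite card_prod card_ord muln_gt0 vertex_gt0. Qed.

Definition blowup (G : graph) : graph :=
  Graph (@blowup_sym G) (@blowup_irr G) (blowup_gt0 G).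

(** Fewer than [n] deletions leave a copy of every vertex, so a path of [G] lifts to the remaining
    copies. *)
Lemma s_connected_blowup (G : graph) :
  (forall x y : G, connect (@adj G) x y) -> 1 < #|G| ->
  s_connected n (blowup G).
Proof.
move=> connG G1; split.
  by rewrite card_prod card_ord leq_pmull // vertex_gt0.
move=> S ltS u v uS vS; set r := (X in connect X).
have adjr (x y : blowup G) : x \notin S -> y \notin S -> adj x.1 y.1 -> r x y.
  by move=> xS yS xy; rewrite /r /= xS yS !andbT /blowup_adj xy.
have rep (x : G) : exists i, ((x, i) : blowup G) \notin S.
  apply/existsP; rewrite -[X in is_true X]negbK negb_exists.
  apply/negP => /forallP allS.
  have sub : [set ((x, i) : blowup G) | i : 'I_n.+1] \subset S.
    by apply/fintype.subsetP => _ /imsetP[i _ ->]; have := allS i; rewrite negbK.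
  have := leq_ltn_trans (subset_leq_card sub) (ltn_trans ltS (ltnSn n)).
  by rewrite card_imset ?card_ord ?ltnn // => c d [].
(* The first edge of a path to any second vertex gives a neighbour. *)
have nbr (x : G) : exists y : G, adj x y.
  have [y yx] : exists y : G, y != x.
    by have /card_gt1P[y [z [_ _]]] := G1; case: (eqVneq y x) => [->|yx _];
      [rewrite eq_sym; exists z|exists y].
  have /connectP[[|z p]] := connG x y.
    by move=> _ /= yx'; rewrite yx' eqxx in yx.
  by move=> /= /andP[xz _] _; exists z.
have /connectP[p] := connG u.1 v.1.
elim: p u uS => [|z p IH] u uS /=.
  (* The lifted path ends at some copy of the vertex below [v], possibly not at [v] itself. Copies
     of one vertex are non-adjacent when [b] is false, so the two are linked through a copy of a
     common neighbour. *)
  move=> _ vu; have [y uy] := nbr u.1; have [i yS] := rep y.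
  apply: (@connect_trans _ _ ((y, i) : blowup G)); apply/connect1/adjr => //=.
  by rewrite vu adj_sym.
move=> /andP[uz zp] vp; have [i zS] := rep z.
apply: (@connect_trans _ _ ((z, i) : blowup G)); first exact/connect1/adjr.
exact: IH.
Qed.

Definition blowupE (i j : 'I_n.+1) x y :=
  if i == j then FEq x y else fconst x false.

Definition blowupA (i j : 'I_n.+1) x y :=
  if b && (i != j) then FOr (FAdj x y) (FEq x y) else FAdj x y.

Lemma blowup_interprets (G : graph) :
  interprets blowupE blowupA (fun (x : G) i => (x, i) : blowup G).
Proof.
split=> [[x i]|i j x y e|i j x y e]; first by exists x, i.
  rewrite /blowupE; case: eqVneq => [->|ij]; first by split=> [/= ->|[]].
  by rewrite sat_fconst; split=> // -[_ /eqP]; rewrite (negbTE ij).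
rewrite /blowupA /= /blowup_adj /=; case: b; case: (i != j) => //=;
  rewrite ?andbT ?andbF ?orbF //.
by split=> [[->//|->]|/orP[|/eqP]]; rewrite ?eqxx ?orbT; auto.
Qed.

Lemma vars_blowupE i j x y : {subset vars (blowupE i j x y) <= [:: x; y]}.
Proof.
move=> z; rewrite /blowupE; case: ifP => _ //.
by rewrite vars_fconst !inE !orbb => ->.
Qed.

Lemma vars_blowupA i j x y : {subset vars (blowupA i j x y) <= [:: x; y]}.
Proof.
move=> z; rewrite /blowupA; case: ifP => _ //.
by rewrite /= !inE; case: (z == x); case: (z == y).
Qed.

Lemma induced_sub_blowup F G : induced_sub F G -> induced_sub F (blowup G).
Proof.
move=> [f [injf adjf]]; exists (fun x => (f x, ord0)); split=> [x y [/injf]//|].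
by move=> x y; rewrite /= /blowup_adj /= adjf ?eqxx !andbF orbF.
Qed.

(** Two vertices of [F] sent to copies of one vertex would be twins whose adjacency is [b]. Hence
    the projection to [G] is injective on the copy of [F]. *)
Lemma induced_sub_blowupV (F G : graph) :
  (~ exists u v : F, twins u v /\ adj u v = b) ->
  induced_sub F (blowup G) -> induced_sub F G.
Proof.
move=> notw [f [injf adjf]].
have inj1 : injective (fun x => (f x).1).
  move=> x y xy; case: (eqVneq x y) => // nxy; case: notw; exists x, y.
  have f2 : (f x).2 != (f y).2.
    apply: contraNneq nxy => xy2; apply/eqP/injf; move: xy xy2.
    by case: (f x) (f y) => [? ?] [? ?] /= -> ->.
  split; first split=> // w wx wy.
    (* If [w] also lands on a copy of the same vertex, its index differs from those of both [x] and
       [y], so both adjacencies equal [b]. *)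
    rewrite -!adjf /= /blowup_adj xy; case: eqVneq => [yw|]; last by rewrite !andbF.
    have f2' z : z != w -> (f z).1 = (f w).1 -> (f z).2 != (f w).2.
      move=> zw e1; apply: contraNneq zw => e2; apply/eqP/injf; move: e1 e2.
      by case: (f z) (f w) => [? ?] [? ?] /= -> ->.
    by rewrite !f2' // ?xy // eq_sym.
  by rewrite -adjf /= /blowup_adj xy adj_irr eqxx f2 !andbT.
exists (fun x => (f x).1); split=> // x y; rewrite -adjf /= /blowup_adj.
case: (eqVneq x y) => [->|xy]; first by rewrite adj_irr !eqxx !andbF.
by rewrite (inj_eq inj1) (negbTE xy) !andbF orbF.
Qed.

Lemma W_blowup (F G H : graph) : (~ exists u v : F, twins u v /\ adj u v = b) ->
  induced_sub F G -> ~ induced_sub F H -> W G H <= W (blowup G) (blowup H).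
Proof.
move=> notw FG FH.
have FG' := induced_sub_blowup FG.
have FH' : ~ induced_sub F (blowup H) by move/(induced_sub_blowupV notw).
exact: (W_interp vars_blowupE vars_blowupA (@blowup_interprets G)
  (@blowup_interprets H) (sentence_diagram F) (diagram_distinguishes FG' FH')).
Qed.

End Blowup.

(** * Components *)

Section Component.
Variables (G : graph) (a : G).

Definition comp_vertex : finType := {x : G | connect (@adj G) a x}.

Definition comp_adj (u v : comp_vertex) : bool := adj (val u) (val v).

Lemma comp_sym : symmetric comp_adj.
Proof. by move=> u v; apply: adj_sym. Qed.

Lemma comp_irr : irreflexive comp_adj.
Proof. by move=> u; apply: adj_irr. Qed.

Definition comp_root : comp_vertex := exist _ a (connect0 (@adj G) a).

Lemma comp_gt0 : 0 < #|comp_vertex|.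
Proof. by apply/card_gt0P; exists comp_root. Qed.

Definition component : graph := Graph comp_sym comp_irr comp_gt0.

Lemma component_sub F : induced_sub F component -> induced_sub F G.
Proof.
move=> [f [injf adjf]]; exists (fun x => val (f x)); split=> // x y /val_inj.
exact: injf.
Qed.

Lemma adj_connect_sym : connect_sym (@adj G).
Proof. by apply: sym_connect_sym => x y; apply: adj_sym. Qed.

Lemma component_connected (u v : component) : connect (@adj component) u v.
Proof.
have from_root w : connect (@adj component) comp_root w.
  (* Induction on the end of the path: every prefix starts at [a], so its last vertex is again in
     the component. *)
  case: w => x ax; case/connectP: (ax) => p; elim/last_ind: p x ax => [|p z IH] x ax /=.
    by move=> _ xa; apply: eq_connect0; apply: val_inj.
  rewrite rcons_path last_rcons => /andP[ap pz] xz.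
  have al : connect (@adj G) a (last a p) by apply/connectP; exists p.
  apply: connect_trans (IH _ al ap erefl) _; apply: connect1.
  by rewrite /= /comp_adj /= xz.
apply: connect_trans (from_root v).
by rewrite sym_connect_sym // => x y; apply: adj_sym.
Qed.

End Component.

(** Every vertex of the copy equals or neighbours the image of [u], so the whole copy lies in the
    component of that image. *)
Lemma induced_sub_component (F G : graph) (u : F) :
  universal u -> induced_sub F G ->
  exists a : G, induced_sub F (component a).
Proof.
move=> univ [f [injf adjf]]; exists (f u).
have fc x : connect (@adj G) (f u) (f x).
  case: (eqVneq x u) => [->//|xu].
  by apply: connect1; rewrite adjf; apply: univ.
by exists (fun x => exist _ (f x) (fc x)); split=> // x y [/injf].
Qed.

(** Reachability in at most [n] steps. After a step from [x] to [z], the value of [x] is no longer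
    needed and [x] becomes the variable of the next step, so three variables suffice for every
    [n]. *)
Fixpoint distf n x y z : formula :=
  if n is n.+1 then FEx z (FAnd (FOr (FEq x z) (FAdj x z)) (distf n z y x))
  else FEq x y.

Lemma sat_distf (G : graph) n x y z (e : nat -> G) : uniq [:: x; y; z] ->
  #|G| <= n -> sat e (distf n x y z) <-> connect (@adj G) (e x) (e y).
Proof.
move=> uxyz leGn.
have upd x' y' z' (a : G) (d : nat -> G) : uniq [:: x'; y'; z'] ->
    [/\ update d z' a x' = d x', update d z' a y' = d y' & uniq [:: z'; y'; x']].
  rewrite /= !inE !negb_or => /and3P[/andP[xy xz] yz _].
  by rewrite !update_neq // (eq_sym z') yz (eq_sym z') xz eq_sym xy.
split.
  elim: n x y z e uxyz {leGn} => [|n IH] x y z e u /=; first by move=> ->.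
  move=> [a [xa]]; have [ex ey u'] := upd _ _ _ a e u.
  move=> /(IH _ _ _ _ u'); rewrite ey; apply: connect_trans.
  by move: xa; rewrite ex updateE => -[->//|xa]; apply: connect1.
move=> /connectP[p ep ely].
(* A duplicate-free path visits at most [#|G|] vertices; paths shorter than [n] are later padded by
   staying in place. *)
have {p ep ely leGn} : exists p,
    [/\ path (@adj G) (e x) p, e y = last (e x) p & size p <= n].
  case/shortenP: ep ely => p' ep' up' _ ely; exists p'; split=> //.
  apply: leq_trans leGn; apply: ltnW; rewrite -[(size p').+1]/(size (e x :: p')).
  by rewrite -(card_uniqP up') max_card.
elim: n x y z e uxyz => [|n IH] x y z e u /= [[|b p]] [] //=.
- by exists (e x); have [ex ey u'] := upd _ _ _ (e x) e u; rewrite ex updateE;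
    split; [left|apply: IH => //; exists [::]; rewrite updateE ey].
- move=> /andP[xb bp] ely szp; exists b; have [ex ey u'] := upd _ _ _ b e u.
  rewrite ex updateE; split; first by right.
  by apply: IH => //; exists p; rewrite updateE ey.
Qed.

Lemma vars_distf n x y z : {subset vars (distf n x y z) <= [:: x; y; z]}.
Proof.
elim: n x y z => [|n IH] x y z w /=; first by rewrite !inE => /orP[] ->; rewrite ?orbT.
have := IH z y x w; rewrite !inE.
by case: (w == x); case: (w == y); case: (w == z) => //= H; rewrite ?orbF => /H.
Qed.

(** * Relativisation of sentences to a component *)

Section Relativize.
Variable n : nat.

(* All variables are kept inside one component, so any variable other than the
   quantified one can serve as the anchor of the relativised quantifier. *)
Definition anchor y : nat := if y == 0 then 1 else 0.

(** The auxiliary variable avoids both [y] and its anchor while staying among 0, 1, 2, so only the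
    three lowest variables can be added. *)
Definition same_comp y := distf n (anchor y) y (if y <= 1 then 2 else 1).

Fixpoint relativize (p : formula) : formula :=
  match p with
  | FEq _ _ | FAdj _ _ => p
  | FNot p => FNot (relativize p)
  | FAnd p q => FAnd (relativize p) (relativize q)
  | FOr p q => FOr (relativize p) (relativize q)
  | FEx x p => FEx x (FAnd (same_comp x) (relativize p))
  | FAll x p => FAll x (FOr (FNot (same_comp x)) (relativize p))
  end.

Lemma sat_same_comp (G : graph) y (e : nat -> G) : #|G| <= n ->
  sat e (same_comp y) <-> connect (@adj G) (e (anchor y)) (e y).
Proof. by apply: sat_distf; case: y => [|[|y]]. Qed.

Lemma sat_relativize (G : graph) (a : G) p (e : nat -> component a) :
  #|G| <= n ->
  sat (fun x => val (e x)) (relativize p) <-> sat e p.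
Proof.
move=> leGn.
have upd (d : nat -> component a) x (w : component a) :
    update (fun y => val (d y)) x (val w) = fun y => val (update d x w y).
  by apply/funext => y; rewrite /update; case: eqP.
have same (d : nat -> component a) x b :
    sat (update (fun y => val (d y)) x b) (same_comp x) <->
    connect (@adj G) a b.
  (* The anchor differs from [x], so it keeps its old value, which lies in the component of [a]. *)
  rewrite sat_same_comp // updateE update_neq; last by case: x => [|[]].
  have da : connect (@adj G) a (val (d (anchor x))) := valP (d (anchor x)).
  by rewrite (same_connect (@adj_connect_sym G) da).
elim: p e => //= [x y|p IH|p IHp q IHq|p IHp q IHq|x p IH|x p IH] e.
- by split=> [/val_inj|->].
- by rewrite IH.
- by rewrite IHp IHq.
- by rewrite IHp IHq.
- split=> [[b [/same ab]]|[w sw]].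
    rewrite -[b]/(val (exist _ b ab : component a)) upd IH => sb.
    by exists (exist _ b ab).
  exists (val w); split; first by apply/same; apply: (valP w).
  by rewrite upd IH.
- split=> [sa w|sw b].
    by case: (sa (val w)) => [[]|]; [apply/same; apply: (valP w)|rewrite upd IH].
  have [ab|nab] := boolP (connect (@adj G) a b); last by left=> /same; apply/negP.
  right; rewrite -[b]/(val (exist _ b ab : component a)) upd IH.
  exact: sw.
Qed.

Lemma vars_relativize m p : 2 < m -> {subset vars p <= iota 0 m} ->
  {subset vars (relativize p) <= iota 0 m}.
Proof.
move=> m2.
have lt3 w : w < 3 -> w \in iota 0 m.
  by move=> w3; rewrite mem_iota /= add0n (leq_trans w3 m2).
have vs x : x \in iota 0 m -> {subset vars (same_comp x) <= iota 0 m}.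
  move=> xm w /vars_distf; rewrite !inE => /or3P[] /eqP-> //; apply: lt3.
    by rewrite /anchor; case: eqP.
  by case: ifP.
elim: p => //= [p IHp q IHq|p IHp q IHq|x p IH|x p IH] pm w.
- rewrite mem_cat => /orP[/IHp|/IHq]; apply=> v vp; apply: pm;
  by rewrite mem_cat vp ?orbT.
- rewrite mem_cat => /orP[/IHp|/IHq]; apply=> v vp; apply: pm;
  by rewrite mem_cat vp ?orbT.
- have xm : x \in iota 0 m by apply: pm; rewrite inE eqxx.
  rewrite inE mem_cat => /or3P[/eqP->//|/(vs _ xm)//|/IH]; apply=> v vp.
  by apply: pm; rewrite inE vp orbT.
- have xm : x \in iota 0 m by apply: pm; rewrite inE eqxx.
  rewrite inE mem_cat => /or3P[/eqP->//|/(vs _ xm)//|/IH]; apply=> v vp.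
  by apply: pm; rewrite inE vp orbT.
Qed.

(** Giving all [m] variables one common value puts every anchor into the component of that vertex,
    where [p] is then evaluated. *)
Definition some_comp m p :=
  exs (iota 0 m)
    (FAnd (bigand 0 (iota 0 m) (fun x => FEq x 0)) (relativize p)).

Lemma vars_some_comp m p : 2 < m -> {subset vars p <= iota 0 m} ->
  {subset vars (some_comp m p) <= iota 0 m}.
Proof.
move=> m2 pm w; rewrite vars_exs mem_cat => /orP[//|].
have m0 : 0 \in iota 0 m by rewrite mem_iota /= add0n (leq_trans _ m2).
rewrite /= mem_cat => /orP[|]; last exact: vars_relativize.
by apply: vars_bigand => // x xm y; rewrite !inE => /orP[] /eqP->.
Qed.

Lemma sentence_some_comp m p : 2 < m -> {subset vars p <= iota 0 m} ->
  sentence (some_comp m p).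
Proof.
move=> m2 pm; apply: sentence_exs => v /free_vars_sub.
move: (@vars_some_comp _ _ m2 pm v); rewrite vars_exs mem_cat => H ?.
by apply: H; apply/orP; right.
Qed.

Lemma models_some_comp (G : graph) m p : 2 < m -> sentence p ->
  {subset vars p <= iota 0 m} -> #|G| <= n ->
  models G (some_comp m p) <-> exists a : G, models (component a) p.
Proof.
move=> m2 sp pm leGn; have [g _] := vertex_inhabited G.
rewrite (models_sat (fun=> g) (sentence_some_comp m2 pm)) sat_exs.
have cst (a : G) : models (component a) p <-> sat (fun=> a) (relativize p).
  rewrite (models_sat (fun=> comp_root a : component a) sp).
  by rewrite -(sat_relativize p _ leGn).
split=> [[e [_ /= [/sat_bigand eq0 se]]]|[a /cst sa]].
  exists (e 0); apply/cst; move: se; apply: (sat_free_vars _).1.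
  by move=> x /free_vars_sub/(vars_relativize m2 pm)/eq0.
exists (fun x => if x \in iota 0 m then a else g); split.
  by move=> x /negbTE->.
split.
  apply/sat_bigand => x xm /=.
  by rewrite xm mem_iota /= add0n (leq_trans _ m2).
move: sa; apply: (sat_free_vars _).1.
by move=> x /free_vars_sub/(vars_relativize m2 pm) ->.
Qed.

End Relativize.

(** Otherwise each component of [H] is separated from [component a] by a sentence in the variables
    below [m]. Their conjunction holds in [component a] and in no component of [H], so the claim
    that some component satisfies it separates [G] from [H] with [m] variables. *)
Lemma W_component (F G H : graph) (a : G) m : 2 < m ->
  induced_sub F (component a) -> ~ induced_sub F H -> m < W G H ->
  exists b : H, m < W (component a) (component b).
Proof.
move=> m2 Fa FH; apply: contraPP => /forallNP small; apply/negP.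
rewrite -leqNgt.
have sep (b : H) : exists p, [/\ sentence p, models (component a) p,
    ~ models (component b) p & {subset vars p <= iota 0 m}].
  have Fb : ~ induced_sub F (component b) by move/component_sub.
  have [p [sp dp wp]] :=
    W_attained (sentence_diagram F) (diagram_distinguishes Fa Fb).
  have [q [sq mq nq vq]] := distinguishes_oriented sp dp.
  apply: rename_iota sq mq nq _; rewrite /width vq -/(width p) wp.
  by have /negP := small b; rewrite -leqNgt.
have [P PP] := choice sep.
pose p := bigand 0 (enum H) P.
have m0 : 0 \in iota 0 m by rewrite mem_iota /= add0n (leq_trans _ m2).
have vp : {subset vars p <= iota 0 m}.
  by apply: vars_bigand => // b _; have [] := PP b.
have sp : sentence p.
  apply: (@sentence_sub p (ftop 0)) => //.
  by apply: free_vars_bigand => b _; have [-> _ _ _] := PP b.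
(* The distance bound [#|G| + #|H|] makes one formula express reachability in both graphs. *)
pose q := some_comp (#|G| + #|H|) m p.
have dq : distinguishes q G H.
  left; split.
    apply/models_some_comp => //; first exact: leq_addr.
    exists a => e; apply/sat_bigand => b _.
    by have [_ mb _ _] := PP b; apply: mb.
  move/(models_some_comp m2 sp vp (leq_addl _ _)) => [b mb].
  have [_ _ nb _] := PP b; apply: nb => e.
  by have /sat_bigand := mb e; apply; rewrite mem_enum.
apply: leq_trans (W_le (sentence_some_comp _ m2 vp) dq) _.
by have := width_le (@vars_some_comp (#|G| + #|H|) _ _ m2 vp); rewrite size_iota.
Qed.

(** A one-vertex [G] forces [F] to be a single vertex, which embeds everywhere; a one-vertex [H] is
    separated from a larger [G] by a two-variable sentence. The sizes serve the connectivity of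
    blow-ups. *)
Lemma W_gt2_card F G H : induced_sub F G -> ~ induced_sub F H ->
  2 < W G H -> 1 < #|G| /\ 1 < #|H|.
Proof.
move=> FG FH W2.
have G1 : 1 < #|G|.
  rewrite ltnNge; apply/negP => G1.
  have [f [injf adjf]] := FG; case: FH.
  have [h _] := vertex_inhabited H; exists (fun=> h).
  have F1 (x y : F) : x = y.
    by apply: injf; apply: (card_le1_eqP G1).
  by split=> x y; [move=> _; apply: F1|rewrite (F1 x y) !adj_irr].
split=> //; rewrite ltnNge; apply/negP => H1.
pose p := FEx 0 (FEx 1 (FNot (FEq 0 1))).
suff dp : distinguishes p G H.
  by have := leq_trans W2 (W_le (erefl : sentence p) dp).
left; split.
  have /card_gt1P[x [y [_ _ xy]]] := G1.
  by move=> e; exists x, y => /=; apply/eqP.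
have [h _] := vertex_inhabited H; move=> /(_ (fun=> h)) [x [y]]; apply.
by rewrite /update /=; apply: (card_le1_eqP H1).
Qed.

(** * Lifting optimal pairs to highly connected ones *)

Theorem theorem5p3 (F : graph) :
  ((~ exists u : F, universal u) -> Wstar_kappa F = Wstar F) /\
  (3 < Wstar F ->
   (~ exists u v : F, twins u v /\ adj u v) \/
   (~ exists u v : F, twins u v /\ ~~ adj u v) ->
   Wstar_kappa F = Wstar F).
Proof.
have nouniv : (~ exists u : F, universal u) -> Wstar_kappa F = Wstar F.
  move=> nou; apply: Wstar_kappa_eq => s G H FG FH _.
  exists (join s G), (join s H); split.
  - exact: induced_sub_join.
  - by move/(induced_sub_joinV nou).
  - exact: s_connected_join.
  - exact: s_connected_join.
  - exact: W_join FH.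
split=> // W3 notw.
have [[u univ]|nou] := pselect (exists u : F, universal u); last exact: nouniv.
(* [b] is an adjacency that no twins of [F] have: true yields cliques, false yields independent sets
   in the blow-up. *)
have [b {}notw] : exists b, ~ exists u v : F, twins u v /\ adj u v = b.
  case: notw => notw; [exists true|exists false] => -[x [y [xy xyb]]];
  by apply: notw; exists x, y; rewrite xyb.
apply: Wstar_kappa_eq => s G H FG FH WGH.
have [a Fa] := induced_sub_component univ FG.
(* Taking [m] one below [W G H] turns the strict bound on the components into
   [W G H <= W (component a) (component c)]; the hypothesis [3 < Wstar F] leaves the three variables
   that reachability takes. *)
have m2 : 2 < (W G H).-1 by rewrite WGH; case: (Wstar F) W3.
have [|c Wac] := W_component m2 Fa FH.
  by rewrite prednK // WGH; case: (Wstar F) W3.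
have Fc : ~ induced_sub F (component c) by move/component_sub.
have [a1 c1] := W_gt2_card Fa Fc (leq_trans m2 (ltnW Wac)).
exists (blowup b s (component a)), (blowup b s (component c)); split.
- exact: induced_sub_blowup.
- by move/(induced_sub_blowupV notw).
- exact: s_connected_blowup (@component_connected _ _) a1.
- exact: s_connected_blowup (@component_connected _ _) c1.
- apply: leq_trans (W_blowup s notw Fa Fc).
  by case: (W G H) Wac.
Qed.
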